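(* Let $E$ be a finite-dimensional vector space over a field and let $\mathrm{cl}:\mathcal{L}(E)\to\mathcal{L}(E)$ satisfy (Cl1)–(Cl4). Let $\mathcal{F}_{\mathrm{cl}}:=\{F\in\mathcal{L}(E):\mathrm{cl}(F)=F\}$. Then $\mathcal{F}_{\mathrm{cl}}$ satisfies the flat axioms (F1)–(F3).
   Context: $\mathcal{L}(E)$ is the lattice of subspaces of $E$. Closure axioms: (Cl1) $A\subseteq\mathrm{cl}(A)$; (Cl2) $A\subseteq B\Rightarrow\mathrm{cl}(A)\subseteq\mathrm{cl}(B)$; (Cl3) $\mathrm{cl}(\mathrm{cl}(A))=\mathrm{cl}(A)$; (Cl4) for all subspaces $A$ and $1$-dimensional $x,y$, if $y\subseteq\mathrm{cl}(A+x)$ and $y\not\subseteq\mathrm{cl}(A)$ then $x\subseteq\mathrm{cl}(A+y)$. For a collection $\mathcal{A}$ and $A,B\in\mathcal{A}$, $B$ covers $A$ in $\mathcal{A}$ if $A\subseteq B$ and every $C\in\mathcal{A}$ with $A\subseteq C\subseteq B$ equals $A$ or $B$. Flat axioms for $\mathcal{F}\subseteq\mathcal{L}(E)$: (F1) $E\in\mathcal{F}$; (F2) $F_1,F_2\in\mathcal{F}\Rightarrow F_1\cap F_2\in\mathcal{F}$; (F3) for every $F\in\mathcal{F}$ and every $1$-dimensional $x\not\subseteq F$ there is a unique cover of $F$ in $\mathcal{F}$ containing $x$. *)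

(* Defs.v *)
From HB Require Import structures.
From mathcomp Require Import all_boot all_order all_algebra.

Set Implicit Arguments.
Unset Strict Implicit.
Unset Printing Implicit Defensive.

Local Open Scope ring_scope.

(* Subspaces are [{vspace E}], on which Leibniz equality is extensional;
   collections of subspaces are arbitrary [Prop]-valued predicates on it. *)

Record closure_axioms (K : fieldType) (E : vectType K)
    (cl : {vspace E} -> {vspace E}) : Prop := ClosureAxioms {
  Cl1 : forall A : {vspace E}, (A <= cl A)%VS;
  Cl2 : forall A B : {vspace E}, (A <= B)%VS -> (cl A <= cl B)%VS;
  Cl3 : forall A : {vspace E}, cl (cl A) = cl A;
  Cl4 : forall A x y : {vspace E}, \dim x = 1%N -> \dim y = 1%N ->
    (y <= cl (A + x))%VS -> ~ (y <= cl A)%VS -> (x <= cl (A + y))%VS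
}.

(* [covers F A B] reads "B covers A in F".  [A = B] is not excluded; in [F3]
   this is immaterial, since the cover contains [x] and [A] does not. *)
Definition covers (K : fieldType) (E : vectType K)
    (F : {vspace E} -> Prop) (A B : {vspace E}) : Prop :=
  [/\ F A, F B, (A <= B)%VS &
    forall C : {vspace E}, F C -> (A <= C)%VS -> (C <= B)%VS -> C = A \/ C = B].

Record flat_axioms (K : fieldType) (E : vectType K)
    (F : {vspace E} -> Prop) : Prop := FlatAxioms {
  F1 : F fullv;
  F2 : forall A B : {vspace E}, F A -> F B -> F (A :&: B)%VS;
  F3 : forall A x : {vspace E}, F A -> \dim x = 1%N -> ~ (x <= A)%VS ->
    exists! B : {vspace E}, covers F A B /\ (x <= B)%VS
}.

Definition closed_subspaces (K : fieldType) (E : vectType K)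
    (cl : {vspace E} -> {vspace E}) : {vspace E} -> Prop :=
  fun F => cl F = F.

(* Main.v *)
Require Import Defs.
From mathcomp Require Import all_boot all_order all_algebra.

(** For a flat [A] and a line [x] outside it, the cover required by [F3] is [cl (A + x)]. By
    [cl_min] this is the least flat containing both [A] and [x], so every cover of [A] through [x]
    lies above it and must equal it. That it does cover [A] is the exchange axiom [Cl4], used in
    [covers_cl_add]. *)

Lemma cl_min (K : fieldType) (E : vectType K) (cl : {vspace E} -> {vspace E})
    (hcl : closure_axioms cl) (A F : {vspace E}) :
  cl F = F -> (A <= F)%VS -> (cl A <= F)%VS.
Proof. by move=> clF sAF; rewrite -clF; apply: Cl2. Qed.

Lemma closed_cap (K : fieldType) (E : vectType K)
    (cl : {vspace E} -> {vspace E}) (hcl : closure_axioms cl)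
    (A B : {vspace E}) :
  cl A = A -> cl B = B -> cl (A :&: B)%VS = (A :&: B)%VS.
Proof.
move=> clA clB; apply/eqP; rewrite eqEsubv (Cl1 hcl) andbT subv_cap.
by rewrite !(cl_min _ _ _ hcl) ?capvSl ?capvSr.
Qed.

(** A flat [C] in between and larger than [A] has a vector [v] outside [A = cl A]; exchanging
    [<[v]>] with [x] puts [x] in [cl (A + <[v]>)], hence in [C]. *)
Lemma covers_cl_add (K : fieldType) (E : vectType K)
    (cl : {vspace E} -> {vspace E}) (hcl : closure_axioms cl)
    (A x : {vspace E}) :
  cl A = A -> \dim x = 1 -> covers (closed_subspaces cl) A (cl (A + x)%VS).
Proof.
move=> clA dimx; split=> //; first exact: Cl3.
  exact: subv_trans (addvSl A x) (Cl1 hcl _).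
move=> C clC sAC sCB; have [sCA | /subvPn[v vC vnA]] := boolP (C <= A)%VS.
  by left; apply/eqP; rewrite eqEsubv sCA.
right; apply/eqP; rewrite eqEsubv sCB /=.
apply: (cl_min _ _ _ hcl) => //; rewrite subv_add sAC /=.
have dimv : \dim <[v]>%VS = 1.
  by rewrite dim_vline; case: eqP vnA => // ->; rewrite mem0v.
have xAv : (x <= cl (A + <[v]>)%VS)%VS.
  (* [v \in C] is by definition [<[v]> <= C], so [vC] serves as an inclusion of subspaces. *)
  apply: (Cl4 hcl) => //; first exact: subv_trans vC sCB.
  by rewrite clA; apply/negP.
apply: subv_trans xAv _; apply: (cl_min _ _ _ hcl) => //.
by rewrite subv_add sAC; apply: vC.
Qed.

Theorem theorem41 (K : fieldType) (E : vectType K)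
    (cl : {vspace E} -> {vspace E}) (hcl : closure_axioms cl) :
  flat_axioms (closed_subspaces cl).
Proof.
split; first by apply/eqP; rewrite eqEsubv subvf (Cl1 hcl).
  exact: closed_cap.
move=> A x clA dimx xnA.
have sAxB : (A + x <= cl (A + x))%VS by apply: Cl1.
have xB : (x <= cl (A + x)%VS)%VS by apply: subv_trans (addvSr A x) sAxB.
exists (cl (A + x)%VS); split; first by split=> //; apply: covers_cl_add.
move=> B [[_ clB sAB coverB] xinB].
(* The flat [cl (A + x)] lies between [A] and [B], so it is one of them; it is not [A], since it
   contains [x]. *)
case: (coverB (cl (A + x)%VS)) => //; first exact: Cl3.
- exact: subv_trans (addvSl A x) sAxB.
- by apply: (cl_min _ _ _ hcl) => //; rewrite subv_add sAB.
- by move=> eqA; case: xnA; rewrite -eqA.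
Qed.
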